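(* A class of Kripke frames is $\mathrm{ML}(\mathbin{\underline{\vee}})$-definable if and only if it is $\mathrm{ML}(\mathsf{A}^+)$-definable.
   Context: Fix a set $\Phi$ of propositional variables. $\mathrm{ML}$-formulas: $\varphi ::= p \mid \neg p \mid (\varphi\wedge\varphi)\mid(\varphi\vee\varphi)\mid\Diamond\varphi\mid\Box\varphi$, $p\in\Phi$. $\mathrm{ML}(\mathsf{A}^+)$ adds only the rule $\varphi::=\mathsf{A}\varphi$, interpreted in Kripke semantics by $\mathfrak{M},w\Vdash\mathsf{A}\varphi$ iff $\varphi$ is true at every point of $\mathfrak{M}$; a formula is valid in a model if true at all points. $\mathrm{ML}(\mathbin{\underline{\vee}})$ adds the rule $\varphi::=(\varphi\mathbin{\underline{\vee}}\varphi)$ and is interpreted in team semantics: for a model $\mathfrak{M}=(W,R,V)$ and $T\subseteq W$: $\mathfrak{M},T\models p$ iff $T\subseteq V(p)$; $\mathfrak{M},T\models\neg p$ iff $T\cap V(p)=\emptyset$; $\wedge$ conjunction; $\mathfrak{M},T\models\varphi\vee\psi$ iff $T=T_1\cup T_2$ with $\mathfrak{M},T_1\models\varphi$, $\mathfrak{M},T_2\models\psi$; $\mathfrak{M},T\models\Diamond\varphi$ iff $\mathfrak{M},T'\models\varphi$ for some $T'$ such that every point of $T$ has an $R$-successor in $T'$ and every point of $T'$ has an $R$-predecessor in $T$; $\mathfrak{M},T\models\Box\varphi$ iff $\mathfrak{M},R[T]\models\varphi$ with $R[T]$ the set of $R$-successors of points of $T$; $\mathfrak{M},T\models\varphi\mathbin{\underline{\vee}}\psi$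 iff $\mathfrak{M},T\models\varphi$ or $\mathfrak{M},T\models\psi$. Such a formula is valid in a model if every team satisfies it. A set of formulas is valid in a frame if valid in every model on that frame (every valuation); a class of frames is $L$-definable if it is the class of frames in which some set of $L$-formulas is valid. *)

(* Defs.v *)
From mathcomp Require Import all_boot.
From mathcomp Require Import boolp classical_sets.

Set Implicit Arguments.
Unset Strict Implicit.
Unset Printing Implicit Defensive.

Local Open Scope classical_set_scope.

(* Frames have a nonempty domain, as is standard for Kripke frames. *)
Record frame : Type := Frame {
  world :> Type;
  acc : world -> world -> Prop;
  world_inhabited : inhabited world }.

Record model (Phi : Type) : Type := Model {
  model_frame :> frame;
  valuation : Phi -> set model_frame }.

(* ML(A+): the universal modality occurs only positively, since negation is
   restricted to propositional variables. *)
Inductive formA (Phi : Type) : Type :=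
  | AVar of Phi
  | ANegVar of Phi
  | AAnd of formA Phi & formA Phi
  | AOr of formA Phi & formA Phi
  | ADia of formA Phi
  | ABox of formA Phi
  | AUniv of formA Phi.

Fixpoint satA (Phi : Type) (M : model Phi) (w : M) (phi : formA Phi) : Prop :=
  match phi with
  | AVar p => valuation p w
  | ANegVar p => ~ valuation p w
  | AAnd a b => satA w a /\ satA w b
  | AOr a b => satA w a \/ satA w b
  | ADia a => exists v : M, acc w v /\ satA v a
  | ABox a => forall v : M, acc w v -> satA v a
  | AUniv a => forall v : M, satA v a
  end.

Definition model_validA (Phi : Type) (M : model Phi) (phi : formA Phi) : Prop :=
  forall w : M, satA w phi.

(* ML with intuitionistic disjunction [TIOr]; [TOr] is the splitting
   disjunction of team semantics. *)
Inductive formT (Phi : Type) : Type :=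
  | TVar of Phi
  | TNegVar of Phi
  | TAnd of formT Phi & formT Phi
  | TOr of formT Phi & formT Phi
  | TDia of formT Phi
  | TBox of formT Phi
  | TIOr of formT Phi & formT Phi.

Definition successors (F : frame) (T : set F) : set F :=
  [set v | exists2 w, T w & acc w v].

Fixpoint satT (Phi : Type) (M : model Phi) (T : set M) (phi : formT Phi)
    : Prop :=
  match phi with
  | TVar p => T `<=` valuation p
  | TNegVar p => T `&` valuation p = set0
  | TAnd a b => satT T a /\ satT T b
  | TOr a b => exists T1 T2 : set M, [/\ T = T1 `|` T2, satT T1 a & satT T2 b]
  | TDia a => exists T' : set M,
      [/\ (forall w, T w -> exists2 v, T' v & acc w v),
          (forall v, T' v -> exists2 w, T w & acc w v)
        & satT T' a]
  | TBox a => satT (successors T) a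
  | TIOr a b => satT T a \/ satT T b
  end.

Definition model_validT (Phi : Type) (M : model Phi) (phi : formT Phi) : Prop :=
  forall T : set M, satT T phi.

(* A logic is given by its formulas [L] and their validity in models. *)
Definition frame_valid (Phi L : Type) (mvalid : model Phi -> L -> Prop)
    (F : frame) (Gamma : set L) : Prop :=
  forall (V : Phi -> set F) (phi : L), Gamma phi -> mvalid (Model V) phi.

Definition definable (Phi L : Type) (mvalid : model Phi -> L -> Prop)
    (C : set frame) : Prop :=
  exists Gamma : set L, C = [set F | frame_valid mvalid F Gamma].

Definition ML_ior_definable (Phi : Type) (C : set frame) : Prop :=
  definable (@model_validT Phi) C.

Definition ML_univ_definable (Phi : Type) (C : set frame) : Prop :=
  definable (@model_validA Phi) C.

(* Main.v *)
Require Import Defs.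
From HB Require Import structures.
From mathcomp Require Import all_boot.
From mathcomp Require Import boolp classical_sets.

(** On every model, a formula of either logic is valid iff some member of a
    finite list of plain modal formulas is globally true, and every such list
    arises in this way from both logics. For team semantics, intuitionistic
    disjunction commutes with all the connectives and plain modal formulas are
    flat. For [A], subformulas [A phi] have the same truth value at all points,
    so that a formula is a disjunction of formulas [chi /\ A gamma] with [chi]
    and [gamma] plain; such a disjunction holds on a whole set [D] of points
    iff, for some set [S] of disjuncts, the [gamma]s in [S] hold globally and
    the [chi]s in [S] jointly cover [D]. *)

Set Implicit Arguments.
Unset Strict Implicit.
Unset Printing Implicit Defensive.

Local Open Scope classical_set_scope.

(** * Plain modal formulas and their flatness *)

Inductive formML (Phi : Type) : Type :=
  | MVar of Phi
  | MNegVar of Phi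
  | MAnd of formML Phi & formML Phi
  | MOr of formML Phi & formML Phi
  | MDia of formML Phi
  | MBox of formML Phi.

(** Classical decidable equality gives [\in] on lists of formulas for an arbitrary type [Phi]. *)
HB.instance Definition _ (Phi : Type) := gen_eqMixin (formML Phi).

Fixpoint formA_of_ML (Phi : Type) (c : formML Phi) : formA Phi :=
  match c with
  | MVar p => AVar p
  | MNegVar p => ANegVar p
  | MAnd a b => AAnd (formA_of_ML a) (formA_of_ML b)
  | MOr a b => AOr (formA_of_ML a) (formA_of_ML b)
  | MDia a => ADia (formA_of_ML a)
  | MBox a => ABox (formA_of_ML a)
  end.

Coercion formA_of_ML : formML >-> formA.

Fixpoint formT_of_ML (Phi : Type) (c : formML Phi) : formT Phi :=
  match c with
  | MVar p => TVar p
  | MNegVar p => TNegVar p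
  | MAnd a b => TAnd (formT_of_ML a) (formT_of_ML b)
  | MOr a b => TOr (formT_of_ML a) (formT_of_ML b)
  | MDia a => TDia (formT_of_ML a)
  | MBox a => TBox (formT_of_ML a)
  end.

(** The syntax has no constants, so a variable is needed here; [formT_inhabited] and
    [formA_inhabited] extract one from any formula. *)
Definition MBot (Phi : Type) (p : Phi) := MAnd (MVar p) (MNegVar p).
Definition MTop (Phi : Type) (p : Phi) := MOr (MVar p) (MNegVar p).

Lemma satA_MTop (Phi : Type) (M : model Phi) (w : M) (p : Phi) :
  satA w (MTop p).
Proof. exact: EM. Qed.

Lemma satT_negvarE (Phi : Type) (M : model Phi) (T : set M) (p : Phi) :
  satT T (TNegVar p) <-> forall w, T w -> ~ valuation p w.
Proof.
split=> [/= TVp w Tw Vw | TVp /=].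
  by have : (T `&` valuation p) w by []; rewrite TVp.
by rewrite -subset0 => w [/TVp].
Qed.

Lemma satT_formT_of_ML (Phi : Type) (M : model Phi) (T : set M)
    (c : formML Phi) :
  satT T (formT_of_ML c) <-> forall w, T w -> satA w c.
Proof.
elim: c T => [p|p|a IHa b IHb|a IHa b IHb|a IHa|a IHa] T.
- by [].
- exact: satT_negvarE.
- split=> /= [[/IHa Ta /IHb Tb] w Tw|Tab]; first by split; [apply: Ta|apply: Tb].
  by split; [apply/IHa|apply/IHb] => w /Tab [].
- split=> /= [[T1 [T2 [-> /IHa Ta /IHb Tb]]] w [/Ta|/Tb]|Tab]; [by left|by right|].
  (* The largest possible parts are taken; they may overlap. *)
  exists [set w | T w /\ satA w a], [set w | T w /\ satA w b].
  split; [|by apply/IHa => w []|by apply/IHb => w []].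
  by apply/seteqP; split=> [w Tw|w [[]|[]]] //; case: (Tab w Tw); [left|right].
- split=> /= [[T' [TT' _ /IHa T'a]] w /TT' [v /T'a va wv]|Ta].
    by exists v.
  (* The largest candidate team: all successors of [T] where [a] is true. *)
  exists [set v | satA v a /\ exists2 w, T w & acc w v]; split.
  + by move=> w Tw; have [v [wv va]] := Ta w Tw; exists v => //; split=> //; exists w.
  + by move=> v [].
  + by apply/IHa => v [].
- split=> /= [/IHa Ta w Tw v wv|Ta]; first by apply: Ta; exists w.
  by apply/IHa => v [w Tw wv]; apply: Ta wv.
Qed.

(** * Resolving intuitionistic disjunctions *)

Fixpoint resolutions (Phi : Type) (phi : formT Phi) : seq (formML Phi) :=
  match phi with
  | TVar p => [:: MVar p]
  | TNegVar p => [:: MNegVar p]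
  | TAnd a b => [seq MAnd c d | c <- resolutions a, d <- resolutions b]
  | TOr a b => [seq MOr c d | c <- resolutions a, d <- resolutions b]
  | TDia a => [seq MDia c | c <- resolutions a]
  | TBox a => [seq MBox c | c <- resolutions a]
  | TIOr a b => resolutions a ++ resolutions b
  end.

(** Every connective evaluates each argument on a single team, so one resolution per argument
    suffices, even under [TBox]. *)
Lemma satT_resolutions (Phi : Type) (M : model Phi) (T : set M)
    (phi : formT Phi) :
  satT T phi <->
  exists2 c, c \in resolutions phi & satT T (formT_of_ML c).
Proof.
elim: phi T => [p|p|a IHa b IHb|a IHa b IHb|a IHa|a IHa|a IHa b IHb] T.
- split=> [Tp|[c /predU1P[->|//] //]].
  by exists (MVar p); rewrite ?mem_seq1.
- split=> [Tp|[c /predU1P[->|//] //]].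
  by exists (MNegVar p); rewrite ?mem_seq1.
- split=> [[/IHa[c ca Tc] /IHb[d db Td]]|[_ /allpairsP[[c d] [/= ca db ->]]]].
    by exists (MAnd c d); first exact: allpairs_f.
  by move=> [Tc Td]; split; [apply/IHa; exists c|apply/IHb; exists d].
- split=> [[T1 [T2 [-> /IHa[c ca Tc] /IHb[d db Td]]]]|].
    by exists (MOr c d); [exact: allpairs_f|exists T1, T2].
  move=> [_ /allpairsP[[c d] [/= ca db ->]] [T1 [T2 [-> Tc Td]]]].
  by exists T1, T2; split=> //; [apply/IHa; exists c|apply/IHb; exists d].
- split=> [[T' [h1 h2 /IHa[c ca Tc]]]|[_ /mapP[c ca ->] [T' [h1 h2 Tc]]]].
    by exists (MDia c); [exact: map_f|exists T'].
  by exists T'; split=> //; apply/IHa; exists c.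
- split=> [/IHa[c ca Tc]|[_ /mapP[c ca ->] Tc]].
    by exists (MBox c); first exact: map_f.
  by apply/IHa; exists c.
- split=> [[/IHa|/IHb] [c cab Tc]|[c]].
  + by exists c; rewrite // mem_cat cab.
  + by exists c; rewrite // mem_cat cab orbT.
  + by rewrite mem_cat => /orP[] h Tc; [left; apply/IHa|right; apply/IHb]; exists c.
Qed.

(** The full team selects one resolution; being flat, that resolution then holds on every team. *)
Lemma model_validT_resolutions (Phi : Type) (M : model Phi) (phi : formT Phi) :
  model_validT M phi <->
  exists2 c, c \in resolutions phi & model_validA M c.
Proof.
split=> [/(_ setT) /satT_resolutions [c cphi /satT_formT_of_ML Mc]|].
  by exists c => // w; apply: Mc.
move=> [c cphi Mc] T; apply/satT_resolutions; exists c => //.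
by apply/satT_formT_of_ML => w _; apply: Mc.
Qed.

(** * Expressing a list of plain formulas in each logic *)

Definition bigTIOr (Phi : Type) (p : Phi) (l : seq (formML Phi)) : formT Phi :=
  foldr (fun c => TIOr (formT_of_ML c)) (formT_of_ML (MBot p)) l.

Lemma resolutions_formT_of_ML (Phi : Type) (c : formML Phi) :
  resolutions (formT_of_ML c) = [:: c].
Proof. by elim: c => //= [a -> b ->|a -> b ->|a ->|a ->]. Qed.

Lemma model_validT_bigTIOr (Phi : Type) (M : model Phi) (p : Phi)
    (l : seq (formML Phi)) :
  model_validT M (bigTIOr p l) <-> exists2 c, c \in l & model_validA M c.
Proof.
have resE : resolutions (bigTIOr p l) = rcons l (MBot p).
  by elim: l => [|c l IHl] //=; rewrite resolutions_formT_of_ML IHl.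
split=> [/model_validT_resolutions|] [c cl Mc]; last first.
  by apply/model_validT_resolutions; exists c; rewrite // resE mem_rcons in_cons cl orbT.
exists c => //; move: cl; rewrite resE mem_rcons in_cons => /orP[/eqP cE|//].
(* The extra candidate [MBot p] fails at every point, and the frame has one. *)
by have [w] := world_inhabited M; move: (Mc w); rewrite cE => -[].
Qed.

Definition bigAUniv (Phi : Type) (p : Phi) (l : seq (formML Phi)) : formA Phi :=
  foldr (fun c => AOr (AUniv (formA_of_ML c))) (MBot p : formA Phi) l.

Lemma model_validA_bigAUniv (Phi : Type) (M : model Phi) (p : Phi)
    (l : seq (formML Phi)) :
  model_validA M (bigAUniv p l) <-> exists2 c, c \in l & model_validA M c.
Proof.
(* The right-hand side does not mention [w], so one point determines validity. *)
have satE (w : M) :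
    satA w (bigAUniv p l) <-> exists2 c, c \in l & model_validA M c.
  elim: l => [|c l IHl]; first by split=> [[]|[]].
  split=> /= [[Mc|/IHl[d dl Md]]|[d]].
  - by exists c; rewrite ?mem_head.
  - by exists d; rewrite ?in_cons ?dl ?orbT.
  - by rewrite in_cons => /orP[/eqP->|dl] Md; [left|right; apply/IHl; exists d].
split=> [Ml|Ml w]; last exact/satE.
by have [w] := world_inhabited M; apply/(satE w)/Ml.
Qed.

(** * Eliminating the universal modality *)

Definition guarded_sat (Phi : Type) (M : model Phi)
    (x : formML Phi * formML Phi) (w : M) : Prop :=
  satA w x.1 /\ model_validA M x.2.

Definition guarded_join (Phi : Type) (x y : formML Phi * formML Phi) :=
  (MOr x.1 y.1, MAnd x.2 y.2).

(** One entry for each choice of a sublist of [l]: the disjunction of its first components, guarded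
    by the conjunction of its second ones. The empty choice gives [(MBot p, MTop p)]. *)
Fixpoint covers (Phi : Type) (p : Phi) (l : seq (formML Phi * formML Phi)) :
    seq (formML Phi * formML Phi) :=
  if l is x :: l' then covers p l' ++ map (guarded_join x) (covers p l')
  else [:: (MBot p, MTop p)].

(** The sublist to choose consists of the pairs whose guard is globally true. The induction lets [D]
    vary, since joining [x] leaves only the points of [D] outside [x.1] to be covered by the
    tail. *)
Lemma coversP (Phi : Type) (M : model Phi) (p : Phi)
    (l : seq (formML Phi * formML Phi)) (D : set M) :
  (forall w, D w -> exists2 x, x \in l & guarded_sat x w) <->
  exists2 y, y \in covers p l &
    (forall w, D w -> satA w y.1) /\ model_validA M y.2.
Proof.
elim: l D => [|x l IHl] D /=.
  split=> [Dl|[_ /predU1P[->|//] [DF _] w /DF []//]].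
  exists (MBot p, MTop p); rewrite ?mem_seq1 //.
  by split=> [w /Dl []|w] //; exact: satA_MTop.
split=> [Dl|[y] /[!mem_cat] /orP[yl [Dy My]|/mapP[z zl ->] [/= Dxz Mxz]] w Dw].
- have [Mx|nMx] := EM (model_validA M x.2).
  + have [|y yl [Dy My]] := (IHl [set w | D w /\ ~ satA w x.1]).1.
      move=> w [/Dl[z /predU1P[-> []//|zl zw]] _]; by exists z.
    exists (guarded_join x y); first by rewrite mem_cat map_f ?orbT.
    split=> [w Dw|w]; last by split; [apply: Mx|apply: My].
    by have [xw|nxw] := EM (satA w x.1); [left|right; apply: Dy].
  (* The guard of [x] fails, so no point of [D] relies on [x]. *)
  + have [|y yl yD] := (IHl D).1; last by exists y; rewrite // mem_cat yl.
    move=> w /Dl[z /predU1P[-> []//|zl zw]]; by exists z.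
- have [|z zl zw] := (IHl D).2 _ w Dw; first by exists y.
  by exists z; rewrite // in_cons zl orbT.
- have Mx : model_validA M x.2 by move=> v; have [] := Mxz v.
  have Mz : model_validA M z.2 by move=> v; have [] := Mxz v.
  have [xw|nxw] := EM (satA w x.1); first by exists x; rewrite ?mem_head.
  have [||t tl tw] := (IHl [set w | D w /\ ~ satA w x.1]).2 _ w.
  + by exists z => //; split=> // v [/Dxz [|]].
  + by split.
  by exists t; rewrite // in_cons tl orbT.
Qed.

(** [ADia] distributes over disjunction and global guards move out of it. [ABox] and [AUniv] do not
    distribute: different points may use different disjuncts, hence [covers]. *)
Fixpoint guarded_forms (Phi : Type) (p : Phi) (phi : formA Phi) :
    seq (formML Phi * formML Phi) :=
  match phi with
  | AVar q => [:: (MVar q, MTop p)]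
  | ANegVar q => [:: (MNegVar q, MTop p)]
  | AAnd a b => [seq (MAnd x.1 y.1, MAnd x.2 y.2)
                  | x <- guarded_forms p a, y <- guarded_forms p b]
  | AOr a b => guarded_forms p a ++ guarded_forms p b
  | ADia a => [seq (MDia x.1, x.2) | x <- guarded_forms p a]
  | ABox a => [seq (MBox x.1, x.2) | x <- covers p (guarded_forms p a)]
  | AUniv a => [seq (MTop p, MAnd x.1 x.2) | x <- covers p (guarded_forms p a)]
  end.

Lemma satA_guarded_forms (Phi : Type) (M : model Phi) (w : M) (p : Phi)
    (phi : formA Phi) :
  satA w phi <-> exists2 x, x \in guarded_forms p phi & guarded_sat x w.
Proof.
have MT : model_validA M (MTop p) by move=> v; exact: satA_MTop.
elim: phi w => [q|q|a IHa b IHb|a IHa b IHb|a IHa|a IHa|a IHa] w.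
- split=> [wq|[x /predU1P[->|//] []//]].
  by exists (MVar q, MTop p); rewrite ?mem_seq1.
- split=> [wq|[x /predU1P[->|//] []//]].
  by exists (MNegVar q, MTop p); rewrite ?mem_seq1.
- split=> [[/IHa[x xa [x1 x2]] /IHb[y yb [y1 y2]]]|].
    exists (MAnd x.1 y.1, MAnd x.2 y.2).
      exact: (allpairs_f (fun x y => (MAnd x.1 y.1, MAnd x.2 y.2))).
    by split.
  move=> [_ /allpairsP[[x y] [/= xa yb ->]] [[x1 y1] Mxy]].
  split; [apply/IHa; exists x|apply/IHb; exists y] => //.
    by split=> // v; have [] := Mxy v.
  by split=> // v; have [] := Mxy v.
- split=> [[/IHa|/IHb] [x xab xw]|[x]].
  + by exists x; rewrite //= mem_cat xab.
  + by exists x; rewrite //= mem_cat xab orbT.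
  + by rewrite mem_cat => /orP[] h xw; [left; apply/IHa|right; apply/IHb]; exists x.
- split=> [[v [wv /IHa[x xa [x1 x2]]]]|[_ /mapP[x xa ->] [[v [wv x1]] x2]]].
    exists (MDia x.1, x.2); first exact: (map_f (fun x => (MDia x.1, x.2))).
    by split=> //; exists v.
  by exists v; split=> //; apply/IHa; exists x.
- split=> [wa|[_ /mapP[y ya ->] [y1 y2]] v wv].
    (* Here the set to be covered is that of the successors of [w]. *)
    have [|y ya [y1 y2]] := (coversP p (guarded_forms p a) [set v | acc w v]).1.
      by move=> v /wa /IHa.
    exists (MBox y.1, y.2); last by split.
    exact: (map_f (fun x => (MBox x.1, x.2))).
  apply/IHa; apply: (coversP p (guarded_forms p a) [set v | acc w v]).2 v wv.
  by exists y.
- split=> [wa|[_ /mapP[y ya ->] [_ My]] v].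
    have [|y ya [y1 y2]] := (coversP p (guarded_forms p a) [set: M]).1.
      by move=> v _; apply/IHa.
    exists (MTop p, MAnd y.1 y.2).
      exact: (map_f (fun x => (MTop p, MAnd x.1 x.2))).
    split; first exact: satA_MTop.
    by move=> v; split; [apply: y1|apply: y2].
  apply/IHa; apply: (coversP p (guarded_forms p a) [set: M]).2 v I.
  by exists y => //; split=> u; have [] := My u.
Qed.

Definition global_forms (Phi : Type) (p : Phi) (phi : formA Phi) :
    seq (formML Phi) :=
  [seq MAnd y.1 y.2 | y <- covers p (guarded_forms p phi)].

(* [phi] is globally true iff [A phi] is true somewhere. *)
Lemma model_validA_global_forms (Phi : Type) (M : model Phi) (p : Phi)
    (phi : formA Phi) :
  model_validA M phi <->
  exists2 c, c \in global_forms p phi & model_validA M c.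
Proof.
have [w] := world_inhabited M.
have -> : model_validA M phi <-> satA w (AUniv phi) by [].
split=> [/(satA_guarded_forms w p) [_ /mapP[y yphi ->] [_ My]]|].
  by exists (MAnd y.1 y.2); first exact: (map_f (fun x => MAnd x.1 x.2)).
move=> [_ /mapP[y yphi ->] My]; apply/(satA_guarded_forms w p).
exists (MTop p, MAnd y.1 y.2); last by split; first exact: satA_MTop.
exact: (map_f (fun x => (MTop p, MAnd x.1 x.2))).
Qed.

Lemma formA_inhabited (Phi : Type) (phi : formA Phi) : inhabited Phi.
Proof. by elim: phi. Qed.

Lemma formT_inhabited (Phi : Type) (phi : formT Phi) : inhabited Phi.
Proof. by elim: phi. Qed.

(** The translation is uniform in the model, so translating a defining set formula by formula
    preserves its validity on every frame under every valuation. *)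
Lemma definable_transfer (Phi L1 L2 : Type) (valid1 : model Phi -> L1 -> Prop)
    (valid2 : model Phi -> L2 -> Prop) (C : set frame) :
  (forall phi, exists psi, forall M, valid1 M phi <-> valid2 M psi) ->
  definable valid1 C -> definable valid2 C.
Proof.
move=> /choice[f validE] [Gamma ->]; exists (f @` Gamma).
apply/seteqP; split=> F FG V; first by move=> _ [phi Gphi <-]; apply/validE/FG.
by move=> phi Gphi; apply/validE/FG; exists phi.
Qed.

Theorem theorem4 (Phi : Type) (C : set frame) :
  ML_ior_definable Phi C <-> ML_univ_definable Phi C.
Proof.
split; apply: definable_transfer => phi.
  have [p] := formT_inhabited phi.
  exists (bigAUniv p (resolutions phi)) => M.
  by rewrite model_validT_resolutions model_validA_bigAUniv.
have [p] := formA_inhabited phi.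
exists (bigTIOr p (global_forms p phi)) => M.
by rewrite (model_validA_global_forms _ p) model_validT_bigTIOr.
Qed.
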